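(* Let $X$ be a metric space with $|X|\ge\mathfrak{c}$, and let $\Sigma=[X]^{\mathfrak{c}}$ be the family of all subsets of $X$ of cardinality $\mathfrak{c}$. Then every function $f\colon X\to\mathbb{R}$ has the HSOP with respect to $\Sigma$. Consequently, if $X$ is additionally separable, then the properties HCRP and HSOP with respect to $\Sigma$ are not equivalent (i.e. there is a function $f\colon X\to\mathbb{R}$ which has the HSOP but not the HCRP with respect to $\Sigma$).
   Context: $\mathfrak{c}$ denotes the cardinality of $\mathbb{R}$. For $g\colon A\to\mathbb{R}$ with $A\subseteq X$ and $x\in A$, $\operatorname{osc}(g,x):=\lim_{\varepsilon\to0^+}\operatorname{diam}(g(A\cap B(x,\varepsilon)))$, where $B(x,\varepsilon)$ is the open ball in $X$. Given a family $\Sigma$ of non-empty subsets of $X$, $f\colon X\to\mathbb{R}$ has the hereditary continuous restriction property (HCRP) with respect to $\Sigma$ if for each $P\in\Sigma$ there is $Q\in\Sigma$, $Q\subseteq P$, such that $f\restriction Q$ is continuous; $f$ has the hereditary small oscillation property (HSOP) with respect to $\Sigma$ if for every $\alpha>0$ and each $P\in\Sigma$ there is $Q\in\Sigma$, $Q\subseteq P$, such that $\operatorname{osc}(f\restriction Q,x)<\alpha$ for all $x\in Q$. *)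

(* Defs.v *)
From HB Require Import structures.
From mathcomp Require Import all_boot all_order all_algebra.
From mathcomp Require Import all_classical all_reals all_analysis.

Set Implicit Arguments.
Unset Strict Implicit.
Unset Printing Implicit Defensive.

Import Order.TTheory GRing.Theory Num.Theory.
Import numFieldTopology.Exports.
Import numFieldNormedType.Exports.

Local Open Scope classical_set_scope.
Local Open Scope ring_scope.
Local Open Scope card_scope.

(* Takes values in [0, +oo] on nonempty sets; the value on set0 is -oo. *)
Definition diam (R : realType) (S : set R) : \bar R :=
  ereal_sup [set `|u - v|%:E | u in S & v in S].

(* Oscillation at x of the restriction of g to A; only meaningful for x in A. *)
Definition osc (R : realType) (X : metricType R) (A : set X) (g : X -> R)
    (x : X) : \bar R :=
  lim (diam (g @` (A `&` ball x e)) @[e --> (0 : R)^'+]).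

Definition HCRP (R : realType) (X : metricType R) (Sigma : set (set X))
    (f : X -> R) : Prop :=
  forall P, Sigma P ->
    exists Q, [/\ Sigma Q, Q `<=` P & {within Q, continuous f}].

Definition HSOP (R : realType) (X : metricType R) (Sigma : set (set X))
    (f : X -> R) : Prop :=
  forall alpha : R, 0 < alpha -> forall P, Sigma P ->
    exists Q, [/\ Sigma Q, Q `<=` P &
      forall x, Q x -> (osc Q f x < alpha%:E)%E].

(* [T]^c: since R is a realType, [set: R] has the cardinality of the
   continuum. *)
Definition continuum_subsets (R : realType) (T : Type) : set (set T) :=
  [set A | A #= [set: R]].
Arguments continuum_subsets R T : clear implicits.

Definition separable (T : topologicalType) : Prop :=
  exists D : set T, countable D /\ dense D.

(* Main.v *)
Require Import Defs.
From HB Require Import structures.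
From mathcomp Require Import all_boot all_order all_algebra.
From mathcomp Require Import all_classical all_reals all_analysis.
From mathcomp Require Import wochoice lra.

(** Both halves are cardinality arguments about the continuum c.

    Small oscillation.  By König's theorem c is not a countable union of
    smaller cardinals ([bigcup_continuum]).  Given P of cardinality c and
    alpha > 0, the preimages under f of the intervals of radius alpha / 3 with
    rational centre cover P, so one of them meets P in a set Q of cardinality
    c; on Q the values of f stay within 2 alpha / 3 of each other, whatever the
    metric of X is ([HSOP_continuum]).

    No continuous restriction.  The function is of Sierpinski-Zygmund type.  In
    a separable space, countably many pieces of rational data (basic ball,
    rational interval) suffice to pin down a continuous function on a subset Q:
    record which basic balls are sent into which intervals.  Decoding such a
    record gives a partial function on X which extends f on Q
    ([within_continuous_coded]), and there are only c records.  This plays the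
    role of Kuratowski's extension theorem to G_delta sets.

    It remains to diagonalise ([exists_diagonal]).  X has cardinality c, so the
    decoded partial functions can be indexed by X itself, and X carries a total
    order all of whose initial segments have fewer than c elements
    ([total_order_small_downsets]).  Choose f x outside the values at x of the
    partial functions with index at most x: there are fewer than c of these,
    and c reals to choose from.  If f were continuous on Q of cardinality c, it
    would agree on Q with the partial function of some index z; then every
    element of Q would lie below z, which is impossible. *)

Set Implicit Arguments.
Unset Strict Implicit.
Unset Printing Implicit Defensive.

Import Order.TTheory GRing.Theory Num.Theory.
Import numFieldTopology.Exports.
Import numFieldNormedType.Exports.

Local Open Scope classical_set_scope.
Local Open Scope ring_scope.
Local Open Scope card_scope.

(** * Comparing cardinals by injections *)

Lemma card_le_injection (T U : Type) (A : set T) (B : set U) (f : T -> U) :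
  {in A &, injective f} -> (forall x, A x -> B (f x)) -> A #<= B.
Proof.
move=> /Pinj[g fg] fAB.
rewrite -(card_ge_image g (X := A) B)//; apply: subset_card_le.
by move=> _ [x Ax <-]; rewrite -fg; exact: fAB.
Qed.

Lemma injection_of_card_le (T U : Type) (B : set U) :
  [set: T] #<= B -> exists i : T -> U, injective i /\ forall t, B (i t).
Proof.
move=> /card_leP/unsquash g.
pose s t : [set: T] := SigSub (mem_set (I : setT t)).
exists (fun t => val (g (s t))); split => [t u /val_inj gtu|t].
  have /(_ _ _ gtu) : injective g by apply: in2TT; apply: inj.
  by move=> /(congr1 val).
by have := valP (g (s t)); rewrite inE.
Qed.

(** * Arithmetic of the continuum *)

(** Sets of naturals embed in the reals through ternary expansions with digits
    0 and 1: a digit 1 at place m outweighs all the digits after it together,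
    since these add up to at most half of 3 ^- m. *)
Section ternary.
Variable R : realType.
Implicit Types C : set nat.

Let ternary_sum C n : R := \sum_(i < n) (val i \in C)%:R / 3 ^+ i.

Let ternary_sumS C n :
  ternary_sum C n.+1 = ternary_sum C n + (n \in C)%:R / 3 ^+ n.
Proof. by rewrite /ternary_sum big_ord_recr. Qed.

Let ternary_sum_tail C p k :
  ternary_sum C (p + k) <=
  ternary_sum C p + (3 ^- p - 3 ^- (p + k)) * (3 / 2).
Proof.
elim: k => [|k IH]; first by rewrite addn0 subrr mul0r addr0.
rewrite addnS ternary_sumS.
have e : 3 ^- (p + k) = 3 * 3 ^- (p + k).+1 :> R.
  by rewrite exprS invfM mulrA divff ?mul1r// pnatr_eq0.
have h : (p + k \in C)%:R / 3 ^+ (p + k) <= 3 ^- (p + k) :> R.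
  by rewrite ler_piMl ?invr_ge0 ?exprn_ge0//; case: (_ \in _).
lra.
Qed.

Let ternary_sum_le C p n :
  ternary_sum C n <= ternary_sum C p + 3 ^- p * (3 / 2).
Proof.
have pos k : 0 < 3 ^- k :> R by rewrite invr_gt0 exprn_gt0.
have [/subnKC <-|/ltnW/subnKC <-] := leqP p n.
  apply: le_trans (ternary_sum_tail _ _ _) _.
  by have := pos (p + (n - p))%N; lra.
have mono k : ternary_sum C n <= ternary_sum C (n + k).
  elim: k => [|k IH]; first by rewrite addn0.
  apply: le_trans IH _; rewrite addnS ternary_sumS lerDl.
  by rewrite divr_ge0 ?exprn_ge0.
by have := mono (p - n)%N; have := pos (n + (p - n))%N; lra.
Qed.

Let ternary_value C : R := sup (range (ternary_sum C)).

(** The first place where two sets differ decides the order of their values. *)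
Let ternary_value_lt C C' m : (forall i, (i < m)%N -> C i <-> C' i) ->
  ~ C m -> C' m -> ternary_value C < ternary_value C'.
Proof.
move=> CC' Cm C'm.
have pos : 0 < 3 ^- m :> R by rewrite invr_gt0 exprn_gt0.
have eqm : ternary_sum C m = ternary_sum C' m.
  apply: eq_bigr => i _; suff -> : (val i \in C) = (val i \in C') by [].
  by apply/idP/idP; rewrite !inE => /(CC' _ (ltn_ord i)).
have low : ternary_sum C m + 3 ^- m <= ternary_value C'.
  have -> : ternary_sum C m + 3 ^- m = ternary_sum C' m.+1.
    by rewrite ternary_sumS eqm mem_set// mul1r.
  apply: ub_le_sup; last by exists m.+1.
  exists (ternary_sum C' 0 + 3 ^- 0 * (3 / 2)) => _ [n _ <-].
  exact: ternary_sum_le.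
have upp : ternary_value C <= ternary_sum C m + 3 ^- m / 2.
  apply: ge_sup; first by exists (ternary_sum C 0); exists 0%N.
  move=> _ [n _ <-]; apply: le_trans (ternary_sum_le _ m.+1 n) _.
  rewrite ternary_sumS memNset// mul0r addr0 lerD2l.
  by rewrite exprS invfM; lra.
lra.
Qed.

Lemma card_le_set_nat_real : [set: set nat] #<= [set: R].
Proof.
apply: (@card_le_injection _ _ _ _ ternary_value) => // C C' _ _ vv.
apply: contrapT => neq.
(* The first place where the two sets differ. *)
have ex : exists m, (m \in C) != (m \in C').
  apply: contrapT => /forallNP h; apply: neq; apply/funext => i.
  have /negP := h i; rewrite negbK => /eqP CC'.
  by rewrite -[C i]in_setE -[C' i]in_setE CC'.
case: (ex_minnP ex) => m Cm min.
have below i : (i < m)%N -> C i <-> C' i.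
  rewrite -[C i]in_setE -[C' i]in_setE => im.
  suff /eqP -> : (i \in C) == (i \in C') by [].
  by apply: contraTT im => /min; rewrite -leqNgt.
have [mC|mC] := boolP (m \in C); have [mC'|mC'] := boolP (m \in C');
  move: Cm; rewrite ?mC ?mC' ?(negbTE mC) ?(negbTE mC') //= => _.
- move: mC mC'; rewrite inE notin_setE => mC mC'.
  have := @ternary_value_lt C' C m (fun i h => iff_sym (below i h)) mC' mC.
  by rewrite vv ltxx.
- move: mC mC'; rewrite inE notin_setE => mC mC'.
  by have := ternary_value_lt below mC mC'; rewrite vv ltxx.
Qed.

End ternary.

Lemma card_le_set_countType_real (R : realType) (T : countType) :
  [set: set T] #<= [set: R].
Proof.
apply: card_le_trans (card_le_set_nat_real R).
apply: (@card_le_injection _ _ _ _ (fun C => pickle @` C)) => // C C' _ _ CC'.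
have pickle_inj : injective (@pickle T) := pcan_inj pickleK.
by apply/funext => t; rewrite -(image_inj pickle_inj) CC' image_inj.
Qed.

(** The cardinal identity c ^ aleph_0 = c.  A countable family of reals is
    determined by its family of Dedekind cuts, which is a single set of pairs
    from a countable type. *)
Lemma card_le_family_real (R : realType) (T : countType) :
  [set: T -> R] #<= [set: R].
Proof.
apply: card_le_trans (card_le_set_countType_real R (T * rat)%type).
pose cut (r : T -> R) := [set tq : T * rat | ratr tq.2 < r tq.1].
have cut_le r s : cut r = cut s -> forall t, r t <= s t.
  move=> rs t; rewrite leNgt; apply/negP => /rat_in_itvoo[q].
  rewrite in_itv/= => /andP[sq qr].
  have : cut r (t, q) by [].
  by rewrite rs /cut/= => /(lt_trans sq); rewrite ltxx.
apply: (@card_le_injection _ _ _ _ cut) => // r s _ _ rs.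
by apply/funext => t; apply/eqP; rewrite eq_le !cut_le.
Qed.

(** König's theorem for the continuum: c has uncountable cofinality.  Inject
    the families of reals indexed by T into the union.  If no A t has
    cardinality c, then for each t some real r t is not the t-th coordinate of
    any family sent into A t; the family r is then sent into none of the
    A t. *)
Lemma bigcup_continuum (R : realType) (V : Type) (T : countType)
    (A : T -> set V) :
  [set: R] #<= \bigcup_t A t -> exists t, [set: R] #<= A t.
Proof.
move=> /injection_of_card_le[i [i_inj iA]].
have [j [j_inj _]] := injection_of_card_le (card_le_family_real R T).
apply: contrapT => /forallNP small.
have missed t : exists r, forall y : T -> R, y t = r -> ~ A t (i (j y)).
  apply: contrapT => /forallNP hit; apply: (small t).
  have {hit} : forall r, exists y : T -> R, y t = r /\ A t (i (j y)).
    move=> r; have /existsNP[y /not_implyP[yt /contrapT Ay]] := hit r.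
    by exists y.
  move=> /choice[y hy].
  apply: (@card_le_injection _ _ _ _ (fun r => i (j (y r)))).
    by move=> r s _ _ /i_inj/j_inj rs; rewrite -(hy r).1 -(hy s).1 rs.
  by move=> r _; exact: (hy r).2.
have [r hr] := choice missed.
by have [t _] := iA (j r); exact: hr.
Qed.

(** * Every function has the small oscillation property *)

(** The diameters shrink with the radius, hence have a limit; this is needed
    because [lim] is meaningful only for convergent functions. *)
Lemma osc_le (R : realType) (X : metricType R) (Q : set X) (f : X -> R)
    (x : X) (c b : R) : Q x -> (forall z, Q z -> `|f z - c| <= b) ->
  (osc Q f x <= (b + b)%:E)%E.
Proof.
move=> Qx fb; apply: lime_le.
  apply: nondecreasing_at_right_is_cvge; near=> e0 => e1 e2 _ _ e12.
  apply: ereal_sup_le => _ [u [z [Qz xz] <-] [v [w [Qw xw] <-] <-]].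
  exists (f z); first by exists z => //; split => //; exact: le_ball xz.
  by exists (f w) => //; exists w => //; split => //; exact: le_ball xw.
near=> e; apply: ge_ereal_sup => _ [_ [z [Qz _] <-] [_ [w [Qw _] <-] <-]].
rewrite lee_fin; have := fb _ Qz; have := fb _ Qw.
rewrite !ler_norml => /andP[? ?] /andP[? ?]; apply/andP; split; lra.
Unshelve. all: by end_near. Qed.

Lemma HSOP_continuum (R : realType) (X : metricType R) (f : X -> R) :
  HSOP (continuum_subsets R X) f.
Proof.
move=> a a0 P cP.
pose A (q : rat) := [set x | P x /\ `|f x - ratr q| <= a / 3].
have PA : P `<=` \bigcup_q A q.
  move=> x Px; have xlt : f x - a / 3 < f x + a / 3 by lra.
  have [q] := rat_in_itvoo xlt; rewrite in_itv/= => /andP[q1 q2].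
  by exists q => //; split => //; rewrite ler_norml; apply/andP; split; lra.
have cRP : [set: R] #<= P.
  by move: cP; rewrite /continuum_subsets/= card_eq_le => /andP[].
have [q cq] :=
  bigcup_continuum (card_le_trans cRP (subset_card_le PA)).
have AP : A q `<=` P by move=> x [].
exists (A q); split => //.
  apply: Cantor_Bernstein cq.
  by rewrite -(card_le_eqr cP); exact: subset_card_le.
move=> x Ax.
have oscA : (osc (A q) f x <= (a / 3 + a / 3)%:E)%E.
  by apply: (osc_le (c := ratr q) Ax) => z [].
by apply: le_lt_trans oscA _; rewrite lte_fin; lra.
Qed.

(** * Diagonalising against continuum many partial functions *)

(** Well-order the reals.  If some initial segment has cardinality c, take the
    least x0 that bounds one.  The elements strictly below x0 are still c
    many, and every initial segment bounded strictly below x0 is small, so it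
    suffices to pull the order back along an injection into that segment. *)
Lemma total_order_small_downsets (R : realType) :
  exists2 le : rel R, total le &
    forall x, ~ ([set: R] #<= [set z | le z x]).
Proof.
have [le wo_le] := well_ordering_principle R.
have minE (A : set R) : A !=set0 -> exists2 z, A z & forall x, A x -> le z x.
  move=> [a Aa]; have [|z [[zA zmin] _]] := wo_le (fun x => `[< A x >]).
    by exists a; exact/asboolP.
  exists z => [|x Ax]; first exact/asboolP.
  by apply: zmin; exact/asboolP.
have tot : total le.
  move=> x y; have [|z [->|->] zle] := minE [set x; y]; first by exists x; left.
    by rewrite zle//; right.
  by rewrite orbC zle//; left.
have anti x y : le x y -> le y x -> x = y.
  move=> xy yx; have [|z [_ zu]] := wo_le (mem [:: x; y]).
    by exists x; rewrite inE eqxx.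
  have refl t : le t t by have := tot t t; rewrite orbb.
  by rewrite -(zu x) ?(zu y)//; split=> [|t]; rewrite ?inE ?eqxx ?orbT //;
    move=> /orP[] /eqP ->.
pose big := [set x | [set: R] #<= [set z | le z x]].
have [big0|nbig] := pselect (big !=set0); last first.
  by exists le => // x xb; apply: nbig; exists x.
have [x0 x0b x0min] := minE _ big0.
(* Removing one point from a set of cardinality c leaves c many. *)
have {x0b} cS : [set: R] #<= [set z | le z x0 /\ z <> x0].
  pose A (b : bool) := if b then [set x0] else [set z | le z x0 /\ z <> x0].
  have /bigcup_continuum[[/=|//]] : [set: R] #<= \bigcup_b A b.
    apply: card_le_trans x0b _; apply: subset_card_le => z zx0.
    by have [->|zne] := pselect (z = x0); [exists true|exists false].
  move=> /injection_of_card_le[i [i_inj i0]].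
  have /eqP := i_inj 0 1 (etrans (i0 0) (esym (i0 1))).
  by rewrite eq_sym oner_eq0.
have [i [i_inj iS]] := injection_of_card_le cS.
exists (fun x y => le (i x) (i y)) => [x y|x]; first exact: tot.
move=> big_x; have [ix0 ixne] := iS x; apply: ixne; apply: anti => //.
apply: x0min; apply: card_le_trans big_x _.
by apply: (@card_le_injection _ _ _ _ i) => // u v _ _ /i_inj.
Qed.

(** G z is the graph of the partial function of index z.  Within fewer than c
    indices, fewer than c values are taken at x, because each graph is
    single-valued; so f x can avoid all G z with z at most x.  If f met one
    G z on all of Q, then Q would be contained in the initial segment of z. *)
Lemma exists_diagonal (R : realType) (X : Type)
    (G : X -> X -> R -> Prop) : [set: X] #<= [set: R] ->
  (forall z x y y', G z x y -> G z x y' -> y = y') ->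
  exists f : X -> R, forall z (Q : set X), [set: R] #<= Q ->
    exists2 x, Q x & ~ G z x (f x).
Proof.
move=> /injection_of_card_le[i [i_inj _]] Gfun.
have [le tot small] := total_order_small_downsets R.
pose down x := [set z | le (i z) (i x)].
have {small} small x : ~ ([set: R] #<= down x).
  move=> /card_le_trans h; apply: (small (i x)); apply: h.
  by apply: (@card_le_injection _ _ _ _ i) => // u v _ _ /i_inj.
have avoid x : exists y, forall z, down x z -> ~ G z x y.
  apply: contrapT => /forallNP hit; apply: (small x).
  have {hit} : forall y, exists z, down x z /\ G z x y.
    move=> y; have /existsNP[z /not_implyP[xz /contrapT Gz]] := hit y.
    by exists z.
  move=> /choice[z hz]; apply: (@card_le_injection _ _ _ _ z).
    by move=> y y' _ _ zz; apply: Gfun (hz y).2 _; rewrite zz; exact: (hz y').2.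
  by move=> y _; exact: (hz y).1.
have [f hf] := choice avoid; exists f => z Q cQ.
apply: contrapT => hQ; apply: (small z); apply: card_le_trans cQ _.
apply: subset_card_le => x Qx.
have /orP[//|zx] := tot (i x) (i z).
by case: hQ; exists x => //; exact: hf.
Qed.

(** * Coding continuous restrictions in a separable space *)

Lemma separable_dense_sequence (R : realType) (X : metricType R) (x0 : X) :
  separable X -> exists d : nat -> X, forall x (e : R), 0 < e ->
    exists n, ball (d n) e x.
Proof.
move=> [D [/countable_injP[j j_inj] dD]].
(* Invert the numbering j of D, with the value x0 off its range. *)
have : forall n, exists x, forall y, D y -> j y = n -> x = y.
  move=> n; have [[y [Dy <-]]|ny] := pselect (exists y, D y /\ j y = n).
    by exists y => z Dz /j_inj -> //; exact/mem_set.
  by exists x0 => y Dy jy; case: ny; exists y.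
move=> /choice[d hd]; exists d => x e e0.
have [||y [/interior_subset xy Dy]] := dD (ball x e)^°.
- by exists x; exact: nbhsx_ballx.
- exact: open_interior.
by exists (j y); rewrite (hd _ y Dy erefl); exact: ball_sym.
Qed.

Lemma exists_natinv_lt (R : realType) (e : R) : 0 < e ->
  exists k : nat, k.+1%:R^-1 < e.
Proof.
move=> e0; have := near_infty_natSinv_lt (PosNum e0) => -[k _ /(_ k)].
by move=> /(_ (leqnn k)); exists k.
Qed.

Section dense_sequence.
Variables (R : realType) (X : metricType R) (d : nat -> X).
Hypothesis dense_d : forall x (e : R), 0 < e -> exists n, ball (d n) e x.

Let basic_ball (p : nat * nat) : set X := ball (d p.1) (p.2.+1%:R^-1 : R).

Let basic_ballP x (e : R) : 0 < e ->
  exists2 p, basic_ball p x & basic_ball p `<=` ball x e.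
Proof.
move=> e0; have e20 : 0 < e / 2 by rewrite divr_gt0.
have [k ke] := exists_natinv_lt e20.
have [|n nx] := @dense_d x (k.+1%:R^-1); first by rewrite invr_gt0.
exists (n, k) => // y ny; apply: le_ball (ball_triangle (ball_sym nx) ny).
by rewrite [leRHS]splitr; apply: lerD; exact: ltW.
Qed.

(** A point is determined by the set of basic balls that contain it. *)
Lemma dense_sequence_card_le : [set: X] #<= [set: R].
Proof.
apply: card_le_trans (card_le_set_countType_real R (nat * nat)%type).
apply: (@card_le_injection _ _ _ _ (fun x => [set p | basic_ball p x])) => //.
move=> x y _ _ xy; apply/eqP.
rewrite -[_ == _]negbK -mdist_gt0; apply/negP => xy0.
have [p px /(_ y)] := basic_ballP x xy0.
have : basic_ball p y by have : [set p | basic_ball p x] p := px; rewrite xy.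
by move=> py /(_ py); rewrite ballEmdist/= ltxx.
Qed.

(** C is a set of pairs (basic ball, rational interval), each read as the
    instruction that the ball is to be mapped into the interval.  The graph of
    the decoded partial function consists of the (x, y) such that y obeys all
    the instructions that apply at x, and these confine y to arbitrarily short
    intervals; the second clause makes the graph single-valued. *)
Definition coded_value (C : set (nat * nat * (rat * rat))) (x : X) (y : R) :=
  (forall c, C c -> basic_ball c.1 x -> ratr c.2.1 <= y <= ratr c.2.2) /\
  (forall e : R, 0 < e -> exists c, [/\ C c, basic_ball c.1 x &
     ratr c.2.2 - ratr c.2.1 < e]).

Lemma coded_value_inj C x y y' :
  coded_value C x y -> coded_value C x y' -> y = y'.
Proof.
move=> [yC small] [y'C _]; apply/eqP; rewrite -subr_eq0 -normr_eq0.
apply/negP => /negP neq.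
have [|c [Cc xc]] := small `|y - y'|; first by rewrite lt_def neq/=.
have := yC c Cc xc; have := y'C c Cc xc => /andP[? ?] /andP[? ?].
apply/negP; rewrite -leNgt ler_norml; apply/andP; split; lra.
Qed.

(** Take all the instructions that f obeys on Q.  Continuity at a point of Q is
    exactly what provides instructions with short intervals there. *)
Lemma within_continuous_coded (f : X -> R) (Q : set X) :
  {within Q, continuous f} ->
  exists C, forall x, Q x -> coded_value C x (f x).
Proof.
move=> fc; exists [set c | forall x, Q x -> basic_ball c.1 x ->
                        ratr c.2.1 <= f x <= ratr c.2.2].
move=> x Qx; split => [c Cc|e e0]; first exact: Cc.
have /rat_in_itvoo[a] : f x - e / 2 < f x by lra.
have /rat_in_itvoo[b] : f x < f x + e / 2 by lra.
rewrite !in_itv/= => /andP[xb be] /andP[ea ax].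
have : nbhs (f x) [set` `](ratr a), (ratr b)[].
  by apply: near_in_itvoo; rewrite in_itv/= ax.
move=> /(fc x); rewrite /nbhs/= -nbhs_subspace_in// => /nbhs_ballP[r r0 rf].
have [p px pr] := basic_ballP x r0.
exists (p, (a, b)); split => //=; last by lra.
move=> y Qy /pr /rf /(_ Qy); rewrite /= in_itv/= => /andP[ay yb].
by rewrite (ltW ay) (ltW yb).
Qed.

End dense_sequence.

Lemma exists_not_HCRP (R : realType) (X : metricType R) :
  [set: R] #<= [set: X] -> separable X ->
  exists f : X -> R, ~ HCRP (continuum_subsets R X) f.
Proof.
move=> cX sepX; have [i _] := injection_of_card_le cX.
have [d dense_d] := separable_dense_sequence (i 0) sepX.
have XR := dense_sequence_card_le dense_d.
have /pfcard_geP[empty|/unsquash h] := card_le_trans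
  (card_le_set_countType_real R (nat * nat * (rat * rat))%type) cX.
  by have : [set: set (nat * nat * (rat * rat))] set0 by []; rewrite empty.
(* The records are c many, so they can be indexed by X along h. *)
have [f hf] := exists_diagonal (G := fun z => coded_value d (h z)) XR
  (fun z => @coded_value_inj _ _ d (h z)).
exists f => /(_ setT) [|Q [cQ _ fQ]]; first exact: Cantor_Bernstein.
have [C hC] := within_continuous_coded dense_d fQ.
have [z _ hz] : (h @` setT) C by apply: surj.
have [|x Qx] := hf z Q.
  by move: cQ; rewrite /continuum_subsets/= card_eq_le => /andP[].
by rewrite hz; apply; exact: hC.
Qed.

Theorem proposition6p2 (R : realType) (X : metricType R)
    (cX : [set: R] #<= [set: X]) :
  (forall f : X -> R, HSOP (continuum_subsets R X) f) /\
  (separable X ->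
     exists f : X -> R,
       HSOP (continuum_subsets R X) f /\ ~ HCRP (continuum_subsets R X) f).
Proof.
split=> [|sepX]; first exact: HSOP_continuum.
have [f fN] := exists_not_HCRP cX sepX.
by exists f; split => //; exact: HSOP_continuum.
Qed.
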